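(* Let $\phi$ be a parabolic linear fractional map with $\phi(\mathbb{D})\subset\mathbb{D}$ which is not an automorphism of $\mathbb{D}$. Then for every $\nu\in\mathbb{R}$, $C_\phi$ is not recurrent on $\mathcal{S}_\nu$.
   Context: $\mathbb{D}$ is the open unit disk of $\mathbb{C}$. For $\nu\in\mathbb{R}$, the weighted Dirichlet space $\mathcal{S}_\nu$ is the Hilbert space of analytic functions $f(z)=\sum_{n\ge 0}a_nz^n$ on $\mathbb{D}$ with $\|f\|_\nu^2=\sum_{n\ge0}|a_n|^2(n+1)^{2\nu}<\infty$. For a self-map $\phi$ of $\mathbb{D}$, $C_\phi f=f\circ\phi$; it is known that $C_\phi$ is bounded on every $\mathcal{S}_\nu$ when $\phi$ is a linear fractional self-map of $\mathbb{D}$. A bounded linear operator $T$ on a Hilbert space $\mathcal{H}$ is recurrent if for every non-empty open $U\subset\mathcal{H}$ there is a positive integer $n$ with $T^n(U)\cap U\neq\emptyset$. A linear fractional map ($\phi(z)=\frac{az+b}{cz+d}$, $ad-bc\ne0$) other than the identity is parabolic if it has only one fixed point in $\hat{\mathbb{C}}=\mathbb{C}\cup\{\infty\}$; for a self-map of $\mathbb{D}$ this fixed point lies on the unit circle. *)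

(* Defs.v *)
From Stdlib Require Import Reals.
From Coquelicot Require Export Coquelicot.

Set Implicit Arguments.
Open Scope R_scope.

(** * The disk and the weighted Dirichlet spaces *)

Definition disk : Type := {z : C | Cmod z < 1}.

Definition expansion (a : nat -> C) (f : disk -> C) : Prop :=
  forall z : disk, @is_pseries C_AbsRing C_NormedModule a (proj1_sig z) (f z).

(* [Rpower x y] is [exp (y * ln x)]; the base [n + 1] is positive. *)
Definition weighted_term (nu : R) (a : nat -> C) (n : nat) : R :=
  Cmod (a n) ^ 2 * Rpower (INR n + 1) (2 * nu).

Definition in_S (nu : R) (f : disk -> C) : Prop :=
  exists a : nat -> C, expansion a f /\ ex_series (weighted_term nu a).

(* The graph of the norm: [is_S_norm nu f r] says that [f] is in the space and
   has norm [r].  The coefficients [a], hence [r], are determined by [f]. *)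
Definition is_S_norm (nu : R) (f : disk -> C) (r : R) : Prop :=
  0 <= r /\
  exists a : nat -> C, expansion a f /\ is_series (weighted_term nu a) (r ^ 2).

Definition S_open (nu : R) (U : (disk -> C) -> Prop) : Prop :=
  (forall f, U f -> in_S nu f) /\
  (forall f, U f ->
    exists eps : R, 0 < eps /\
      forall g, in_S nu g ->
        forall r, is_S_norm nu (fun z => g z - f z)%C r -> r < eps -> U g).

(** * Composition operators and recurrence *)

Definition comp_op (phi : disk -> disk) (f : disk -> C) : disk -> C :=
  fun z => f (phi z).

(* [T] acts on all functions on the disk.  When it maps the space into itself,
   this is recurrence of its restriction, since [U] lies in the space; the
   definition makes sense without that invariance. *)
Definition recurrent (nu : R) (T : (disk -> C) -> (disk -> C)) : Prop :=
  forall U : (disk -> C) -> Prop,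
    S_open nu U -> (exists f, U f) ->
    exists n : nat, (0 < n)%nat /\ exists f, U f /\ U (Nat.iter n T f).

(** * Linear fractional maps of the Riemann sphere *)

(* [None] is the point at infinity. *)
Definition sphere : Type := option C.

Record lin_frac : Type := LinFrac {
  lf_a : C;
  lf_b : C;
  lf_c : C;
  lf_d : C;
  lf_det : (lf_a * lf_d - lf_b * lf_c)%C <> 0%C
}.

Definition lf_map (m : lin_frac) (p : sphere) : sphere :=
  match p with
  | Some z =>
      if Ceq_dec (lf_c m * z + lf_d m)%C 0%C then None
      else Some ((lf_a m * z + lf_b m) / (lf_c m * z + lf_d m))%C
  | None =>
      if Ceq_dec (lf_c m) 0%C then None else Some (lf_a m / lf_c m)%C
  end.

Definition parabolic (m : lin_frac) : Prop :=
  ~ (forall p, lf_map m p = p) /\ exists! p, lf_map m p = p.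

(* [m] maps the disk into itself and [phi] is its restriction to the disk. *)
Definition restricts_to (m : lin_frac) (phi : disk -> disk) : Prop :=
  forall z : disk, lf_map m (Some (proj1_sig z)) = Some (proj1_sig (phi z)).

(* For the restriction of a linear fractional map, holomorphy is automatic, so
   being an automorphism of the disk amounts to being a bijection. *)
Definition disk_automorphism (phi : disk -> disk) : Prop :=
  (forall z w, phi z = phi w -> z = w) /\ (forall w, exists z, phi z = w).

(* Main.v *)
Require Import Defs.
From Stdlib Require Import Reals Lra Lia Factorial ProofIrrelevance.
From Coquelicot Require Import Coquelicot.

(** In the coordinate [w = (alpha + z) / (alpha - z)], where [alpha] is the
    fixed point, [phi] is the translation [w -> w + t] of the right half-plane,
    and [Re t > 0] because [phi] is not an automorphism.  So the orbit of [0] is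
    [z_n = alpha (1 - 2 / (2 + n t))].  For an analytic [f] let [L_n f] be the
    [k]-th forward difference at [n] of [n -> f (z_n)], so that
    [L_n f = L_0 (T^n f)] with [T = C_phi].  Differentiating [k] times in [n]
    gives [|L_n (z^m)| <= B (m + 1)^-k] uniformly in [n], so for [k] large
    depending on [nu] the functionals [L_n] are uniformly bounded on [S_nu]: the
    differences absorb the polynomial growth of [f] along the orbit.  On the
    other hand, for the identity function [f0], the [|L_n f0|] are explicit and
    decrease strictly with [n], so [|L_n f0 - L_0 f0|] is bounded below by some
    [d > 0] for [n >= 1].  The functions [f] with
    [sup_n |L_n f - L_n f0| < d / 2] then form a non-empty open set that
    is disjoint from its image under every [T^n]. *)

(** * Forward differences of complex sequences *)

(** Only the difference at index 0 is taken; a difference at [n] is that of the shifted sequence. *)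
Fixpoint diff (k : nat) (u : nat -> C) : C :=
  match k with
  | O => u O
  | S k => (diff k (fun j => u (S j)) - diff k u)%C
  end.

Lemma diff_ext k u v : (forall j, u j = v j) -> diff k u = diff k v.
Proof.
  revert u v; induction k as [|k IH]; intros u v H; simpl; [apply H|].
  rewrite (IH u v H), (IH _ (fun j => v (S j))); auto.
Qed.

Lemma diff_scal k a u : diff k (fun j => (a * u j)%C) = (a * diff k u)%C.
Proof.
  revert u; induction k as [|k IH]; intros u; simpl; [reflexivity|].
  rewrite (IH u), (IH (fun j => u (S j))); ring.
Qed.

Lemma diff_minus k u v :
  diff k (fun j => (u j - v j)%C) = (diff k u - diff k v)%C.
Proof.
  revert u v; induction k as [|k IH]; intros u v; simpl; [reflexivity|].
  rewrite (IH u v), (IH (fun j => u (S j)) (fun j => v (S j))); ring.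
Qed.

Lemma diff_const k a : diff (S k) (fun _ => a) = 0%C.
Proof. induction k as [|k IH]; simpl in *; [|rewrite IH]; ring. Qed.

Lemma is_series_diff k (b : nat -> nat -> C) (u : nat -> C) :
  (forall j, @is_series C_AbsRing C_NormedModule (b j) (u j)) ->
  @is_series C_AbsRing C_NormedModule
    (fun m => diff k (fun j => b j m)) (diff k u).
Proof.
  revert b u; induction k as [|k IH]; intros b u H; simpl; [apply H|].
  apply (is_series_minus (K := C_AbsRing) (V := C_NormedModule));
    [apply (IH (fun j => b (S j)) (fun j => u (S j))) | apply IH]; auto.
Qed.

(** * Calculus for complex functions of a real variable *)

Definition is_Cderive (f : R -> C) (x : R) (l : C) : Prop :=
  is_derive (fun x => Re (f x)) x (Re l) /\
  is_derive (fun x => Im (f x)) x (Im l).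

Lemma is_Cderive_const a x : is_Cderive (fun _ => a) x 0%C.
Proof. split; apply (is_derive_const (V := R_NormedModule)). Qed.

Lemma is_Cderive_minus f g x lf lg :
  is_Cderive f x lf -> is_Cderive g x lg ->
  is_Cderive (fun x => (f x - g x)%C) x (lf - lg)%C.
Proof.
  intros [Hf1 Hf2] [Hg1 Hg2]; split;
    apply (is_derive_minus (V := R_NormedModule)); assumption.
Qed.

Lemma is_Cderive_mult f g x lf lg :
  is_Cderive f x lf -> is_Cderive g x lg ->
  is_Cderive (fun x => (f x * g x)%C) x (lf * g x + f x * lg)%C.
Proof.
  intros [Hf1 Hf2] [Hg1 Hg2]; split; simpl.
  - evar_last.
    apply (is_derive_minus (V := R_NormedModule));
      apply (is_derive_mult (K := R_AbsRing)); eauto; apply Rmult_comm.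
    cbn; unfold Re, Im; ring.
  - evar_last.
    apply (is_derive_plus (V := R_NormedModule));
      apply (is_derive_mult (K := R_AbsRing)); eauto; apply Rmult_comm.
    cbn; unfold Re, Im; ring.
Qed.

Lemma is_Cderive_eq f x l l' : is_Cderive f x l -> l = l' -> is_Cderive f x l'.
Proof. intros H <-; exact H. Qed.

Lemma is_Cderive_scal a f x l :
  is_Cderive f x l -> is_Cderive (fun x => (a * f x)%C) x (a * l)%C.
Proof.
  intros H; eapply is_Cderive_eq;
    [apply is_Cderive_mult; [apply is_Cderive_const|exact H] | cbv beta; ring].
Qed.

Lemma is_Cderive_pow f x l n :
  is_Cderive f x l ->
  is_Cderive (fun x => (f x ^ n)%C) x (INR n * f x ^ pred n * l)%C.
Proof.
  intros H; induction n as [|n IH].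
  - apply (is_Cderive_eq _ _ 0%C); [apply (is_Cderive_const 1%C) | simpl; ring].
  - eapply is_Cderive_eq;
      [apply (is_Cderive_mult f (fun x => (f x ^ n)%C)); [exact H|exact IH]|].
    cbv beta; rewrite S_INR, RtoC_plus; destruct n as [|n];
      [simpl; ring | generalize (INR (S n)); intros r; simpl; ring].
Qed.

Lemma is_Cderive_shift f x a l :
  is_Cderive f (x + a) l -> is_Cderive (fun x => f (x + a)) x l.
Proof.
  intros [H1 H2]; split.
  - evar_last;
    [apply (is_derive_comp (fun x => Re (f x)) (fun x => x + a));
      [exact H1|auto_derive; auto]|].
    cbn; ring.
  - evar_last;
    [apply (is_derive_comp (fun x => Im (f x)) (fun x => x + a));
      [exact H2|auto_derive; auto]|].
    cbn; ring.
Qed.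

Lemma is_Cderive_diff k (F : nat -> R -> C) (u : nat -> C) x :
  (forall j, is_Cderive (F j) x (u j)) ->
  is_Cderive (fun x => diff k (fun j => F j x)) x (diff k u).
Proof.
  revert F u; induction k as [|k IH]; intros F u H; simpl; [apply H|].
  apply is_Cderive_minus;
    [apply (IH (fun j => F (S j)) (fun j => u (S j)))|apply IH]; auto.
Qed.

Lemma is_Cderive_diff_shift k (f g : R -> C) x :
  (forall y, x <= y -> is_Cderive f y (g y)) ->
  is_Cderive (fun x => diff k (fun j => f (x + INR j))) x
    (diff k (fun j => g (x + INR j))).
Proof.
  intros H; apply (is_Cderive_diff k (fun j x => f (x + INR j))).
  intros j; apply is_Cderive_shift, H; pose proof (pos_INR j); lra.
Qed.

Lemma Cmod_le_abs z : Cmod z <= Rabs (Re z) + Rabs (Im z).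
Proof.
  apply Rsqr_incr_0_var;
    [|pose proof (Rabs_pos (Re z)); pose proof (Rabs_pos (Im z)); lra].
  rewrite !Rsqr_pow2, Cmod2_alt, <- (pow2_abs (Re z)), <- (pow2_abs (Im z)).
  pose proof (Rabs_pos (Re z)); pose proof (Rabs_pos (Im z)); nra.
Qed.

Lemma im_le_Cmod z : Rabs (Im z) <= Cmod z.
Proof. eapply Rle_trans; [apply Rmax_r|apply Rmax_Cmod]. Qed.

(** The mean value theorem acts on real and imaginary parts separately, at possibly different
    points, hence the factor 2. *)
Lemma Cderive_increment_bound f g a b M :
  a < b -> (forall x, a <= x -> is_Cderive f x (g x)) ->
  (forall x, a <= x -> Cmod (g x) <= M) ->
  Cmod (f b - f a) <= 2 * M * (b - a).
Proof.
  intros Hab Hd HM.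
  destruct (MVT_cor2 (fun x => Re (f x)) (fun x => Re (g x)) a b Hab)
    as [c [Hc Hc']].
  { intros x Hx; apply is_derive_Reals, Hd; lra. }
  destruct (MVT_cor2 (fun x => Im (f x)) (fun x => Im (g x)) a b Hab)
    as [d [Hd1 Hd']].
  { intros x Hx; apply is_derive_Reals, Hd; lra. }
  eapply Rle_trans; [apply Cmod_le_abs|].
  change (Rabs (Re (f b) - Re (f a)) + Rabs (Im (f b) - Im (f a))
          <= 2 * M * (b - a)).
  rewrite Hc, Hd1, !Rabs_mult, (Rabs_pos_eq (b - a)) by lra.
  pose proof (re_le_Cmod (g c)); pose proof (im_le_Cmod (g d)).
  pose proof (HM c ltac:(lra)); pose proof (HM d ltac:(lra)); nra.
Qed.

(** * The orbit in the half-plane coordinate and its derivatives *)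

(* The value of [1 / (w + 1)] at [w = 1 + x t]. *)
Definition half_inv (t : C) (x : R) : C := (/ (2 + x * t))%C.

(** The falling factorial [m (m - 1) ... (m - i + 1)]; subtraction is real, so a factor is zero when
    [i > m]. *)
Fixpoint ffact (i m : nat) : R :=
  match i with
  | O => 1
  | S i => ffact i m * (INR m - INR i)
  end.

(* The derivative of a term of index [(p, i)] is a combination of terms of
   indices [(p + 1, i)] and [(p + 1, i + 1)], and each term is
   [O ((m + 1) ^ -p)]; the [m]-th power of the orbit is the term [(0, 0)].  When
   [i > m] the truncated exponent is harmless: the falling factorial vanishes. *)
Definition orbit_mono (t : C) (p i m : nat) (x : R) : C :=
  (ffact i m * half_inv t x ^ (p + i) * (1 - 2 * half_inv t x) ^ (m - i))%C.

Lemma Cmod2_denom (t : C) (x : R) :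
  Cmod (2 + x * t) ^ 2 = 4 + 4 * x * Re t + x ^ 2 * Cmod t ^ 2.
Proof. rewrite !Cmod2_alt; destruct t; cbn; ring. Qed.

Section Orbit.

Variable t : C.
Hypothesis t_pos : 0 < Re t.

Lemma denom_neq_0 (x : R) : 0 <= x -> (2 + x * t)%C <> 0%C.
Proof.
  intros Hx H; apply (f_equal Re) in H; destruct t as [a b]; cbn in *; nra.
Qed.

Lemma is_Cderive_half_inv x :
  0 <= x -> is_Cderive (half_inv t) x (- t * half_inv t x ^ 2)%C.
Proof.
  intros Hx; destruct t as [a b]; cbn in t_pos.
  assert (Hn : 0 < (2 + x * a) * (2 + x * a) + (x * b) * (x * b)) by nra.
  split.
  - apply (is_derive_ext (fun x => (2 + x * a) /
             ((2 + x * a) * (2 + x * a) + (x * b) * (x * b)))).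
    { intros y; cbn; f_equal; [ring|f_equal; ring]. }
    auto_derive; [lra|]. cbn; field; repeat split; nra.
  - apply (is_derive_ext (fun x => - (x * b) /
             ((2 + x * a) * (2 + x * a) + (x * b) * (x * b)))).
    { intros y; cbn; f_equal; [ring|f_equal; ring]. }
    auto_derive; [lra|]. cbn; field; repeat split; nra.
Qed.

Lemma ffact_over i m : (m < i)%nat -> ffact i m = 0.
Proof.
  induction i as [|i IH]; intros H; [lia|]; simpl.
  destruct (Nat.eq_dec m i) as [->|]; [ring|rewrite IH by lia; ring].
Qed.

(** As [half_inv] has derivative [- t half_inv ^ 2], differentiating its power raises [p];
    differentiating the other power also brings out [m - i], which raises [i]. *)
Lemma is_Cderive_mono p i m x :
  0 <= x ->
  is_Cderive (orbit_mono t p i m) x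
    (- t * INR (p + i) * orbit_mono t (S p) i m x
     + 2 * t * orbit_mono t (S p) (S i) m x)%C.
Proof.
  intros Hx; unfold orbit_mono.
  pose proof (is_Cderive_half_inv x Hx) as Hv.
  eapply is_Cderive_eq.
  - apply is_Cderive_mult.
    + apply is_Cderive_scal, is_Cderive_pow, Hv.
    + apply is_Cderive_pow, is_Cderive_minus;
        [apply is_Cderive_const | apply is_Cderive_scal, Hv].
  (* The exponent [m - i] extends the falling factorial; for [m < i] both sides vanish. *)
  - assert (Hf : (ffact i m * INR (m - i) = ffact (S i) m)%C).
    { rewrite <- RtoC_mult; f_equal; simpl.
      destruct (Nat.le_gt_cases i m);
        [rewrite minus_INR by lia; ring|rewrite ffact_over by lia; ring]. }
    rewrite <- Hf; replace (m - S i)%nat with (pred (m - i)) by lia.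
    replace (S p + S i)%nat with (S (S (p + i))) by lia.
    change (S p + i)%nat with (S (p + i)).
    generalize (half_inv t x); intros v.
    generalize (INR (m - i)); intros r.
    destruct (p + i)%nat as [|n];
      [simpl; ring | generalize (INR (S n)); intros r'; simpl; ring].
Qed.

(** The first bound comes from [Re (2 + x t) >= d (x + 1)], the second from [|x t| ^ 2 = |2 + x t| ^
    2 - (4 + 4 x Re t)] and [1 - y <= exp (- y)]. *)
Lemma half_inv_bounds :
  exists A c, 0 < A /\ 0 < c /\ forall x, 0 <= x ->
    Cmod (half_inv t x) <= A / (x + 1) /\
    Cmod (1 - 2 * half_inv t x) <= exp (- (c / (x + 1))).
Proof.
  set (d := Rmin 1 (Re t)); set (T := Cmod t).
  assert (Hd : 0 < d) by (apply Rmin_pos; lra).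
  assert (Hd1 : d <= 1) by apply Rmin_l.
  assert (Hdt : d <= Re t) by apply Rmin_r.
  assert (HT : 0 <= T) by apply Cmod_ge_0.
  assert (HtT : Re t <= T).
  { eapply Rle_trans; [apply Rle_abs|apply re_le_Cmod]. }
  (* The second constant comes from [N <= (2 + T) (x + 1)]; it has 2 instead of 4 because the
     modulus is squared. *)
  exists (/ d), (2 * d / (2 + T) ^ 2).
  split; [apply Rinv_0_lt_compat, Hd|].
  split; [apply Rdiv_lt_0_compat; nra|].
  intros x Hx; pose proof (denom_neq_0 x Hx) as Hn.
  pose proof (Cmod2_denom t x) as HN; fold T in HN.
  pose proof (Cmod_gt_0 (2 + x * t)%C) as [Hpos _]; specialize (Hpos Hn).
  set (N := Cmod (2 + x * t)) in *.
  split.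
  - unfold half_inv; rewrite Cmod_inv by exact Hn; fold N.
    unfold Rdiv; rewrite <- Rinv_mult; apply Rinv_le_contravar; [nra|].
    assert (Hre : Re (2 + x * t)%C <= N).
    { eapply Rle_trans; [apply Rle_abs|apply re_le_Cmod]. }
    replace (Re (2 + x * t)%C) with (2 + x * Re t) in Hre
      by (destruct t; cbn; ring).
    nra.
  - apply Rsqr_incr_0_var; [|left; apply exp_pos].
    unfold Rsqr at 2; rewrite <- exp_plus, Rsqr_pow2.
    assert (Hq : (1 - 2 * half_inv t x = x * t / (2 + x * t))%C).
    { unfold half_inv; field; exact Hn. }
    rewrite Hq, Cmod_div, Cmod_mult, Cmod_R, (Rabs_pos_eq x Hx) by exact Hn.
    fold N T.
    eapply Rle_trans; [|apply exp_ineq1_le].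
    apply Rle_trans with (1 - (4 + 4 * x * Re t) / N ^ 2).
    { right; field_simplify_eq; [rewrite HN; ring|lra]. }
    cut (2 * (2 * d / (2 + T) ^ 2 / (x + 1)) <= (4 + 4 * x * Re t) / N ^ 2);
      [lra|].
    apply Rle_trans with (4 * d * (x + 1) / ((2 + T) * (x + 1)) ^ 2).
    { right; field; lra. }
    assert (HNle : N ^ 2 <= ((2 + T) * (x + 1)) ^ 2).
    { apply Rle_trans with ((2 + x * T) ^ 2); [rewrite HN; nra|].
      apply pow_incr; nra. }
    unfold Rdiv; apply Rmult_le_compat;
      [nra | left; apply Rinv_0_lt_compat, pow_lt; nra | nra |].
    apply Rinv_le_contravar; [apply pow_lt; exact Hpos | exact HNle].
Qed.

End Orbit.

(** * Uniform decay of the differences of powers along the orbit *)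

(** Half of the exponential absorbs one factor [y], as [y exp (- c y / 2) <= 2 / c]; the other half
    serves the induction. *)
Lemma pow_mult_exp_bounded N c :
  0 < c -> exists K, forall y, 0 <= y -> y ^ N * exp (- (c * y)) <= K.
Proof.
  revert c; induction N as [|N IH]; intros c Hc.
  - exists 1; intros y Hy; simpl; rewrite Rmult_1_l, <- exp_0.
    destruct (Req_dec y 0) as [->|]; [right; f_equal; ring|].
    left; apply exp_increasing; nra.
  - destruct (IH (c / 2)) as [K HK]; [lra|].
    exists (2 / c * K); intros y Hy.
    replace (exp (- (c * y))) with (exp (- (c / 2 * y)) * exp (- (c / 2 * y)))
      by (rewrite <- exp_plus; f_equal; field).
    replace (y ^ S N * (exp (- (c / 2 * y)) * exp (- (c / 2 * y)))) with
      ((y * exp (- (c / 2 * y))) * (y ^ N * exp (- (c / 2 * y))))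
      by (simpl; ring).
    pose proof (exp_pos (- (c / 2 * y))).
    apply Rmult_le_compat; auto.
    + nra.
    + apply Rmult_le_pos; [apply pow_le, Hy|lra].
    + rewrite exp_Ropp; pose proof (exp_ineq1_le (c / 2 * y)).
      apply Rmult_le_reg_r with (exp (c / 2 * y)); [apply exp_pos|].
      rewrite Rmult_assoc, Rinv_l by (pose proof (exp_pos (c / 2 * y)); lra).
      apply Rle_trans with (2 / c * (1 + c / 2 * y)).
      * replace (2 / c * (1 + c / 2 * y)) with (2 / c + y) by (field; lra).
        assert (0 < 2 / c) by (apply Rdiv_lt_0_compat; lra); lra.
      * apply Rmult_le_compat_l; [|lra].
        left; apply Rdiv_lt_0_compat; lra.
Qed.

Lemma ffact_bounds i m :
  (i <= m)%nat -> 0 <= ffact i m <= (INR m + 1) ^ i.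
Proof.
  induction i as [|i IH]; intros H; simpl; [lra|].
  destruct IH as [H1 H2]; [lia|].
  assert (INR i <= INR m) by (apply le_INR; lia).
  pose proof (pos_INR i).
  split; [nra|].
  rewrite Rmult_comm; apply Rmult_le_compat; lra.
Qed.

Lemma exp_pow_nat y n : exp y ^ n = exp (INR n * y).
Proof.
  induction n as [|n IH]; [simpl; rewrite Rmult_0_l, exp_0; reflexivity|].
  rewrite S_INR; simpl; rewrite IH, <- exp_plus; f_equal; ring.
Qed.

(** With [Y = (m + 1) / (x + 1)] everything reduces to [Y ^ (p + i) exp (- c Y)], which is bounded;
    so [B] is uniform in [m] and [x] together. *)
Lemma mono_bound t p i :
  0 < Re t -> exists B, forall m x, 0 <= x ->
    Cmod (orbit_mono t p i m x) * (INR m + 1) ^ p <= B.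
Proof.
  intros Ht; destruct (half_inv_bounds t Ht) as (A & c & HA & Hc & H).
  destruct (pow_mult_exp_bounded (p + i) c Hc) as [K HK].
  assert (HK0 : 0 <= K).
  { eapply Rle_trans; [|apply (HK 0); lra].
    apply Rmult_le_pos; [apply pow_le; lra|left; apply exp_pos]. }
  assert (HAp : 0 <= A ^ (p + i)) by (apply pow_le; lra).
  pose proof (exp_pos (c * (INR i + 1))) as He.
  exists (A ^ (p + i) * K * exp (c * (INR i + 1))); intros m x Hx.
  unfold orbit_mono; rewrite !Cmod_mult, Cmod_R, !Cmod_pow.
  pose proof (pos_INR m) as Hm.
  destruct (Nat.le_gt_cases i m) as [Him|Him].
  2: { rewrite ffact_over by exact Him; rewrite Rabs_R0, !Rmult_0_l.
       apply Rmult_le_pos; [apply Rmult_le_pos|]; lra. }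
  destruct (ffact_bounds i m Him) as [Hf0 Hf].
  rewrite Rabs_pos_eq by exact Hf0.
  destruct (H x Hx) as [Hv Hq].
  set (Y := (INR m + 1) / (x + 1)).
  assert (HY : 0 <= Y) by (apply Rdiv_le_0_compat; lra).
  apply Rle_trans with
    ((INR m + 1) ^ i * (A / (x + 1)) ^ (p + i)
     * exp (- (c / (x + 1))) ^ (m - i) * (INR m + 1) ^ p).
  { apply Rmult_le_compat_r; [apply pow_le; lra|].
    apply Rmult_le_compat; try (apply pow_incr; split; auto using Cmod_ge_0).
    - apply Rmult_le_pos; [exact Hf0|apply pow_le, Cmod_ge_0].
    - apply pow_le, Cmod_ge_0.
    - apply Rmult_le_compat; auto; [apply pow_le, Cmod_ge_0|].
      apply pow_incr; auto using Cmod_ge_0. }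
  rewrite exp_pow_nat.
  (* From [m - i = (m + 1) - (i + 1)]; the second part costs at most the factor
     [exp (c (i + 1))]. *)
  replace (INR (m - i) * - (c / (x + 1)))
    with (- (c * Y) + c * ((INR i + 1) / (x + 1)))
    by (rewrite minus_INR by exact Him; unfold Y; field; lra).
  rewrite exp_plus.
  replace ((INR m + 1) ^ i * (A / (x + 1)) ^ (p + i) *
           (exp (- (c * Y)) * exp (c * ((INR i + 1) / (x + 1)))) *
           (INR m + 1) ^ p)
    with (A ^ (p + i) * (Y ^ (p + i) * exp (- (c * Y)))
          * exp (c * ((INR i + 1) / (x + 1)))).
  2: { unfold Y, Rdiv; rewrite !Rpow_mult_distr, !pow_add; ring. }
  apply Rmult_le_compat; [| left; apply exp_pos | |].
  - apply Rmult_le_pos; [exact HAp|].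
    apply Rmult_le_pos; [apply pow_le, HY|left; apply exp_pos].
  - apply Rmult_le_compat_l; auto.
  - assert (Hle : c * ((INR i + 1) / (x + 1)) <= c * (INR i + 1)).
    { pose proof (pos_INR i).
      apply Rmult_le_compat_l; [lra|]; apply Rle_div_l; nra. }
    destruct Hle as [Hlt|Heq];
      [left; apply exp_increasing, Hlt | right; f_equal; exact Heq].
Qed.

(** A difference is controlled by a derivative, and a derivative raises [p] by one: each of the [k]
    differences gains a factor [1 / (m + 1)]. *)
Lemma diff_mono_bound t k p i :
  0 < Re t -> exists B, forall m x, 0 <= x ->
    Cmod (diff k (fun j => orbit_mono t p i m (x + INR j))) * (INR m + 1) ^ (p + k)
    <= B.
Proof.
  intros Ht; revert p i; induction k as [|k IH]; intros p i.
  - destruct (mono_bound t p i Ht) as [B HB]; exists B; intros m x Hx.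
    rewrite Nat.add_0_r; simpl; rewrite Rplus_0_r; auto.
  - destruct (IH (S p) i) as [B1 H1], (IH (S p) (S i)) as [B2 H2].
    exists (2 * (Cmod t * INR (p + i) * B1 + 2 * Cmod t * B2)); intros m x Hx.
    set (D := fun x => diff k (fun j => orbit_mono t p i m (x + INR j))).
    replace (diff (S k) (fun j => orbit_mono t p i m (x + INR j)))
      with (D (x + 1)%R - D x)%C.
    2: { simpl; unfold D; f_equal; apply diff_ext; intros j; f_equal.
         destruct j; simpl; ring. }
    set (W := (INR m + 1) ^ (p + S k)).
    assert (HW : 0 < W) by (apply pow_lt; pose proof (pos_INR m); lra).
    apply Rle_div_r; [exact HW|].
    set (M := (Cmod t * INR (p + i) * B1 + 2 * Cmod t * B2) / W).
    replace (2 * _ / W) with (2 * M * (x + 1 - x)) by (unfold M; field; lra).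
    apply Cderive_increment_bound with
      (g := fun x => diff k (fun j =>
        (- t * INR (p + i) * orbit_mono t (S p) i m (x + INR j)%R
         + 2 * t * orbit_mono t (S p) (S i) m (x + INR j)%R)%C)); [lra| |].
    + intros y Hy; unfold D.
      apply (is_Cderive_diff_shift k (orbit_mono t p i m) (fun y =>
        (- t * INR (p + i) * orbit_mono t (S p) i m y
         + 2 * t * orbit_mono t (S p) (S i) m y)%C)).
      intros z Hz; apply is_Cderive_mono; auto; lra.
    + intros y Hy; specialize (H1 m y ltac:(lra)); specialize (H2 m y ltac:(lra)).
      replace (S p + k)%nat with (p + S k)%nat in H1, H2 by lia.
      fold W in H1, H2.
      rewrite (diff_ext _ _ (fun j =>
        (- t * INR (p + i) * orbit_mono t (S p) i m (y + INR j)%R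
         - - (2 * t) * orbit_mono t (S p) (S i) m (y + INR j)%R)%C))
        by (intros j; ring).
      rewrite (diff_minus k (fun j =>
         (- t * INR (p + i) * orbit_mono t (S p) i m (y + INR j)%R)%C)).
      rewrite !diff_scal.
      unfold M; apply Rle_div_r; [exact HW|].
      set (D1 := diff k (fun j => orbit_mono t (S p) i m (y + INR j)%R)) in *.
      set (D2 := diff k (fun j => orbit_mono t (S p) (S i) m (y + INR j)%R)) in *.
      apply Rle_trans with
        (Cmod t * INR (p + i) * (Cmod D1 * W) + 2 * Cmod t * (Cmod D2 * W)).
      * apply Rle_trans with
          ((Cmod t * INR (p + i) * Cmod D1 + 2 * Cmod t * Cmod D2) * W);
          [|right; ring].
        apply Rmult_le_compat_r; [lra|].
        unfold Cminus; eapply Rle_trans; [apply Cmod_triangle|].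
        rewrite !Cmod_opp, !Cmod_mult, !Cmod_opp, !Cmod_mult, !Cmod_R.
        rewrite (Rabs_pos_eq 2), (Rabs_pos_eq (INR _)) by
          (try apply pos_INR; lra).
        lra.
      * pose proof (Cmod_ge_0 t); pose proof (pos_INR (p + i)).
        apply Rplus_le_compat; apply Rmult_le_compat_l; auto; nra.
Qed.

Lemma diff_power_bound t k :
  0 < Re t -> exists B, forall m n : nat,
    Cmod (diff k (fun j => ((1 - 2 * half_inv t (INR (n + j))) ^ m)%C))
    <= B / (INR m + 1) ^ k.
Proof.
  intros Ht; destruct (diff_mono_bound t k 0 0 Ht) as [B HB].
  exists B; intros m n.
  apply Rle_div_r; [apply pow_lt; pose proof (pos_INR m); lra|].
  eapply Rle_trans; [|apply (HB m (INR n)), pos_INR].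
  right; f_equal; f_equal; apply diff_ext; intros j.
  unfold orbit_mono; rewrite Nat.sub_0_r, plus_INR; simpl; ring.
Qed.

(** * Closed form of the differences of [half_inv] *)

Fixpoint denom_prod (t : C) (k : nat) (x : R) : C :=
  match k with
  | O => (2 + x * t)%C
  | S k => (denom_prod t k x * (2 + (x + INR (S k))%R * t))%C
  end.

Lemma denom_prod_S t k (x : R) :
  denom_prod t (S k) x
  = (denom_prod t k x * (2 + (x + INR (S k))%R * t))%C.
Proof. reflexivity. Qed.

(** Both [denom_prod t k x] and [denom_prod t k (x + 1)] thus divide [denom_prod t (S k) x], the
    common denominator of the next difference. *)
Lemma denom_prod_shift t k (x : R) :
  denom_prod t (S k) x = ((2 + x * t) * denom_prod t k (x + 1)%R)%C.
Proof.
  induction k as [|k IH]; [reflexivity|].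
  rewrite denom_prod_S, IH, (denom_prod_S t k).
  replace (x + INR (S (S k))) with (x + 1 + INR (S k))
    by (rewrite !S_INR; ring).
  ring.
Qed.

Lemma denom_prod_neq_0 t k x :
  0 < Re t -> 0 <= x -> denom_prod t k x <> 0%C.
Proof.
  intros Ht Hx; induction k as [|k IH];
    [exact (denom_neq_0 t Ht x Hx)|].
  apply Cmult_neq_0; [exact IH|apply denom_neq_0; auto].
  pose proof (pos_INR (S k)); lra.
Qed.

(** Over the common denominator [denom_prod t (S k) x] the numerators differ by [(2 + x t) - (2 + (x
    + k + 1) t) = - (k + 1) t], which extends the power and the factorial. *)
Lemma diff_half_inv t k x :
  0 < Re t -> 0 <= x ->
  diff k (fun j => half_inv t (x + INR j)) =
  ((- t) ^ k * INR (fact k) / denom_prod t k x)%C.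
Proof.
  intros Ht; revert x; induction k as [|k IH]; intros x Hx.
  - pose proof (denom_neq_0 t Ht x Hx).
    simpl; rewrite Rplus_0_r; unfold half_inv; field; assumption.
  - simpl diff.
    rewrite (diff_ext _ (fun j => half_inv t (x + INR (S j)))
               (fun j => half_inv t (x + 1 + INR j))).
    2: { intros j; f_equal; rewrite S_INR; ring. }
    rewrite (IH x), (IH (x + 1)) by lra.
    pose proof (denom_prod_neq_0 t k x Ht Hx) as H0.
    pose proof (denom_prod_neq_0 t k (x + 1) Ht ltac:(lra)) as H1.
    pose proof (denom_neq_0 t Ht x Hx) as H2.
    assert (H3 : (2 + (x + INR (S k))%R * t)%C <> 0%C).
    { apply denom_neq_0; auto; pose proof (pos_INR (S k)); lra. }
    pose proof (denom_prod_shift t k x) as Hs; rewrite denom_prod_S in Hs |- *.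
    apply (f_equal (fun w => (w / (denom_prod t k x * denom_prod t k (x + 1)))%C))
      in Hs.
    rewrite (Cmult_comm (denom_prod t k x) (2 + _)).
    rewrite fact_simpl, mult_INR, RtoC_mult, Cpow_S.
    assert (Hd : (/ denom_prod t k (x + 1) - / denom_prod t k x =
            - t * INR (S k) / ((2 + (x + INR (S k))%R * t) * denom_prod t k x))%C).
    { replace (/ denom_prod t k (x + 1))%C with
        ((2 + x * t) / ((2 + (x + INR (S k))%R * t) * denom_prod t k x))%C.
      - rewrite RtoC_plus; field; rewrite <- RtoC_plus; auto.
      - replace (2 + (x + INR (S k))%R * t)%C with
          ((2 + x * t) * denom_prod t k (x + 1) / denom_prod t k x)%C.
        + field; auto.
        + transitivity (denom_prod t k (x + 1) *
            ((2 + x * t) * denom_prod t k (x + 1) /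
             (denom_prod t k x * denom_prod t k (x + 1))))%C;
            [field; auto | rewrite <- Hs; field; auto]. }
    transitivity ((- t) ^ k * INR (fact k) *
      (/ denom_prod t k (x + 1) - / denom_prod t k x))%C;
      [field; auto | rewrite Hd; field; auto].
Qed.

(** By [Cmod2_denom], each factor has modulus strictly increasing in [x >= 0]. *)
Lemma Cmod_denom_prod_lt t k x y :
  0 < Re t -> 0 <= x < y ->
  Cmod (denom_prod t k x) < Cmod (denom_prod t k y).
Proof.
  intros Ht.
  assert (Hlt : forall x y : R, 0 <= x < y ->
                  Cmod (2 + x * t) < Cmod (2 + y * t)).
  { intros a b Hab; apply Rsqr_incrst_0; try apply Cmod_ge_0.
    rewrite !Rsqr_pow2, !Cmod2_denom.
    pose proof (pow2_ge_0 (Cmod t)).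
    assert (a ^ 2 <= b ^ 2) by (apply pow_incr; lra); nra. }
  intros Hxy; induction k as [|k IH]; [simpl; auto|]; rewrite !denom_prod_S.
  pose proof (pos_INR (S k)).
  rewrite !Cmod_mult.
  apply Rmult_le_0_lt_compat; auto using Cmod_ge_0; apply Hlt; lra.
Qed.

Lemma diff_half_inv_gap t k :
  0 < Re t -> exists d, 0 < d /\ forall n, (0 < n)%nat ->
    d <= Cmod (diff k (fun j => half_inv t (INR (n + j)))
               - diff k (fun j => half_inv t (INR (0 + j)))).
Proof.
  intros Ht.
  assert (Hd : forall n, diff k (fun j => half_inv t (INR (n + j))) =
    ((- t) ^ k * INR (fact k) / denom_prod t k (INR n))%C).
  { intros n; rewrite <- diff_half_inv by (auto using pos_INR).
    apply diff_ext; intros j; rewrite plus_INR; reflexivity. }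
  set (c := ((- t) ^ k * INR (fact k))%C) in *.
  assert (Hc : 0 < Cmod c).
  { apply Cmod_gt_0, Cmult_neq_0; [apply Cpow_nz|].
    - intros H; apply (f_equal Re) in H; cbn in H.
      unfold Re in Ht; lra.
    - intros H; apply RtoC_inj in H; pose proof (INR_fact_lt_0 k); lra. }
  assert (Hp : forall x, 0 <= x -> 0 < Cmod (denom_prod t k x)).
  { intros x Hx; apply Cmod_gt_0, denom_prod_neq_0; auto. }
  assert (Hlt : / Cmod (denom_prod t k 1) < / Cmod (denom_prod t k 0)).
  { apply Rinv_lt_contravar; [apply Rmult_lt_0_compat; apply Hp; lra|].
    apply Cmod_denom_prod_lt; auto; lra. }
  (* The drop in modulus from index 0 to index 1 serves for all [n >= 1], since the moduli decrease
     and the reverse triangle inequality applies. *)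
  exists (Cmod c * (/ Cmod (denom_prod t k 0) - / Cmod (denom_prod t k 1))).
  split; [nra|].
  intros n Hn; rewrite !Hd.
  assert (H1n : Cmod (denom_prod t k 1) <= Cmod (denom_prod t k (INR n))).
  { destruct n as [|[|n]]; [lia|simpl; lra|].
    left; apply Cmod_denom_prod_lt; auto; rewrite !S_INR.
    pose proof (pos_INR n); lra. }
  apply Rle_trans with
    (Cmod (c / denom_prod t k (INR 0)) - Cmod (c / denom_prod t k (INR n))).
  - pose proof (pos_INR n).
    rewrite !Cmod_div by (apply denom_prod_neq_0; auto; simpl; lra).
    simpl INR at 1.
    assert (/ Cmod (denom_prod t k (INR n)) <= / Cmod (denom_prod t k 1))
      by (apply Rinv_le_contravar; [apply Hp; lra|exact H1n]).
    unfold Rdiv; nra.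
  - set (u := (c / denom_prod t k (INR 0))%C).
    set (v := (c / denom_prod t k (INR n))%C).
    pose proof (Cmod_triangle v (- (v - u))%C) as Htr.
    rewrite Cmod_opp in Htr.
    replace (v + - (v - u))%C with u in Htr by ring; lra.
Qed.

(** * Series and coefficient estimates *)

Lemma is_series_norm_le {K : AbsRing} {V : NormedModule K}
  (b : nat -> V) (l : V) (M : R) :
  is_series b l -> (forall N, sum_n (fun m => norm (b m)) N <= M) -> norm l <= M.
Proof.
  intros Hb HM.
  assert (H : is_lim_seq (fun N => norm (sum_n b N)) (norm l)).
  { eapply filterlim_comp; [exact Hb|apply filterlim_norm]. }
  apply (is_lim_seq_le _ (fun _ => M) (norm l) M) in H;
    [exact H| |apply is_lim_seq_const].
  intros N; eapply Rle_trans; [apply norm_sum_n_m|apply HM].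
Qed.

Lemma is_series_single {K : AbsRing} {V : NormedModule K} (b : nat -> V) p :
  (forall m, m <> p -> b m = zero) -> is_series b (b p).
Proof.
  intros H.
  assert (Hlt : forall N, (N < p)%nat -> sum_n b N = zero).
  { induction N as [|N IH]; intros HN.
    - rewrite sum_O; apply H; lia.
    - rewrite sum_Sn, IH, H by lia; apply plus_zero_l. }
  assert (Hge : forall N, (p <= N)%nat -> sum_n b N = b p).
  { induction N as [|N IH]; intros HN.
    - replace p with 0%nat by lia; apply sum_O.
    - rewrite sum_Sn; destruct (Nat.eq_dec p (S N)) as [->|Hne].
      + rewrite Hlt by lia; apply plus_zero_l.
      + rewrite IH, (H (S N)) by lia; apply plus_zero_r. }
  eapply filterlim_ext_loc; [|apply (filterlim_const (b p))].
  exists p; intros N HN; symmetry; apply Hge, HN.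
Qed.

(** Telescoping: from [m = 1] on, each term is at most [1 / m - 1 / (m + 1)]. *)
Lemma sum_inv_square_le N :
  sum_n (fun m => / (INR m + 1) ^ 2) N <= 2 - / (INR N + 1).
Proof.
  induction N as [|N IH]; [rewrite sum_O; simpl; lra|].
  rewrite sum_Sn.
  change (sum_n (fun m => / (INR m + 1) ^ 2) N + / (INR (S N) + 1) ^ 2
          <= 2 - / (INR (S N) + 1)).
  rewrite S_INR; pose proof (pos_INR N).
  assert (/ (INR N + 1 + 1) ^ 2 <= / (INR N + 1) - / (INR N + 1 + 1)); [|lra].
  replace (/ (INR N + 1) - / (INR N + 1 + 1))
    with (/ ((INR N + 1) * (INR N + 1 + 1))) by (field; lra).
  apply Rinv_le_contravar; nra.
Qed.

(** A single term of a non-negative series is at most the sum [r ^ 2]; the bound is the square root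
    of this. *)
Lemma coeff_le nu a r m :
  0 <= r -> is_series (weighted_term nu a) (r ^ 2) ->
  Cmod (a m) <= r * Rpower (INR m + 1) (- nu).
Proof.
  intros Hr Ha.
  assert (Hpos : forall m, 0 <= weighted_term nu a m).
  { intros i; apply Rmult_le_pos; [apply pow2_ge_0|left; apply exp_pos]. }
  assert (Hm : weighted_term nu a m <= r ^ 2).
  { apply Rle_trans with (sum_n (weighted_term nu a) m).
    - destruct m as [|m]; [rewrite sum_O; lra|].
      rewrite sum_Sn.
      assert (0 <= sum_n (weighted_term nu a) m).
      { clear - Hpos; induction m as [|m IH]; [rewrite sum_O; auto|].
        rewrite sum_Sn; apply Rplus_le_le_0_compat; auto. }
      change (weighted_term nu a (S m) <=
        sum_n (weighted_term nu a) m + weighted_term nu a (S m)); lra.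
    - apply (is_lim_seq_incr_compare (sum_n (weighted_term nu a)) (r ^ 2) Ha).
      intros n; rewrite sum_Sn.
      change (sum_n (weighted_term nu a) n <=
        sum_n (weighted_term nu a) n + weighted_term nu a (S n)).
      specialize (Hpos (S n)); lra. }
  unfold weighted_term in Hm.
  replace (2 * nu) with (nu + nu) in Hm by ring.
  rewrite Rpower_plus in Hm; rewrite Rpower_Ropp.
  set (w := Rpower (INR m + 1) nu) in *.
  assert (Hw : 0 < w) by apply exp_pos.
  apply Rle_div_r; [exact Hw|].
  apply Rsqr_incr_0_var; [|exact Hr].
  rewrite !Rsqr_pow2; nra.
Qed.

(** * Difference functionals along the orbit *)

Section ParabolicOrbit.

Variables (alpha t : C) (z : nat -> disk).
Hypothesis alpha_unit : Cmod alpha = 1.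
Hypothesis t_pos : 0 < Re t.
Hypothesis z_orbit :
  forall n, proj1_sig (z n) = (alpha * (1 - 2 * half_inv t (INR n)))%C.

Lemma pow_n_Cpow (c : C) n : @pow_n C_Ring c n = (c ^ n)%C.
Proof. induction n as [|n IH]; [reflexivity|simpl; rewrite IH; reflexivity]. Qed.

(** Of the [K + 2] differences, [K] offset the growth [(m + 1) ^ (- nu)] of the coefficients and two
    leave the summable [(m + 1) ^ (- 2)]. *)
Lemma orbit_diff_bounded nu K :
  - nu <= INR K -> exists M, forall h r n, is_S_norm nu h r ->
    Cmod (diff (S (S K)) (fun j => h (z (n + j)%nat))) <= M * r.
Proof.
  intros HK; destruct (diff_power_bound t (S (S K)) t_pos) as [B HB].
  exists (B * 2); intros h r n [Hr [a [Ha Hs]]].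
  set (b := fun j m => (a m * (proj1_sig (z (n + j)%nat)) ^ m)%C).
  assert (Hb : forall j, @is_series C_AbsRing C_NormedModule (b j) (h (z (n + j)%nat))).
  { intros j; eapply is_series_ext; [|apply Ha].
    intros m; unfold b; rewrite Cmult_comm, <- pow_n_Cpow; reflexivity. }
  apply (is_series_diff (S (S K))) in Hb.
  assert (HB0 : 0 <= B).
  { specialize (HB 0%nat 0%nat); eapply Rle_trans in HB; [|apply Cmod_ge_0].
    simpl INR in HB; rewrite Rplus_0_l, pow1 in HB; lra. }
  refine (is_series_norm_le _ _ _ Hb _); intros N.
  apply Rle_trans with (sum_n (fun m => scal (B * r) (/ (INR m + 1) ^ 2)) N).
  2: { rewrite sum_n_scal_l.
       pose proof (sum_inv_square_le N) as Hsq.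
       assert (0 < / (INR N + 1))
         by (apply Rinv_0_lt_compat; pose proof (pos_INR N); lra).
       change (B * r * sum_n (fun m => / (INR m + 1) ^ 2) N <= B * 2 * r).
       assert (0 <= B * r) by (apply Rmult_le_pos; assumption); nra. }
  apply sum_n_m_le; intros m.
  change (Cmod (diff (S (S K)) (fun j => b j m)) <= B * r * / (INR m + 1) ^ 2).
  rewrite (diff_ext _ _ (fun j =>
    (a m * alpha ^ m * (1 - 2 * half_inv t (INR (n + j))) ^ m)%C)).
  2: { intros j; unfold b; rewrite z_orbit, Cpow_mult_l; ring. }
  rewrite diff_scal, !Cmod_mult, Cmod_pow, alpha_unit, pow1, Rmult_1_r.
  pose proof (pos_INR m).
  apply Rle_trans with
    (r * (INR m + 1) ^ K * (B / (INR m + 1) ^ S (S K))).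
  - apply Rmult_le_compat; auto using Cmod_ge_0.
    eapply Rle_trans; [apply (coeff_le _ _ _ _ Hr Hs)|].
    apply Rmult_le_compat_l; [exact Hr|].
    rewrite <- Rpower_pow by lra.
    apply Rle_Rpower; lra.
  - right; simpl; field; split; [lra|]. apply pow_nonzero; lra.
Qed.

(** The orbit is affine in [half_inv]. At least one difference is taken, so the constant [alpha]
    drops out and a factor of modulus 2 remains. *)
Lemma orbit_diff_identity_gap k :
  exists d, 0 < d /\ forall n, (0 < n)%nat ->
    d <= Cmod (diff (S k) (fun j => proj1_sig (z (n + j)%nat))
               - diff (S k) (fun j => proj1_sig (z (0 + j)%nat))).
Proof.
  destruct (diff_half_inv_gap t (S k) t_pos) as [d [Hd Hgap]].
  exists (2 * d); split; [lra|]; intros n Hn.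
  assert (Hz : forall n, diff (S k) (fun j => proj1_sig (z (n + j)%nat)) =
    (- (2 * alpha) * diff (S k) (fun j => half_inv t (INR (n + j))))%C).
  { clear n Hn; intros n.
    rewrite (diff_ext _ _ (fun j =>
      (alpha - 2 * alpha * half_inv t (INR (n + j)))%C)).
    2: { intros j; rewrite z_orbit; ring. }
    rewrite (diff_minus (S k) (fun _ => alpha)), diff_const, diff_scal; ring. }
  rewrite !Hz.
  match goal with |- _ <= Cmod (?c * ?u - ?c * ?v)%C =>
    replace (c * u - c * v)%C with (c * (u - v))%C by ring end.
  rewrite Cmod_mult, Cmod_opp, Cmod_mult, alpha_unit, Cmod_R, Rabs_pos_eq by lra.
  specialize (Hgap n Hn); lra.
Qed.

End ParabolicOrbit.

(** * From the orbit to non-recurrence *)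

Lemma in_S_identity nu : in_S nu (fun z => proj1_sig z).
Proof.
  set (a := fun m => if Nat.eq_dec m 1 then RtoC 1 else RtoC 0).
  exists a; split.
  - intros z; unfold is_pseries.
    evar_last.
    + apply (is_series_single
        (fun k => scal (pow_n (proj1_sig z) k) (a k : C_NormedModule)) 1).
      intros m Hm; unfold a; destruct (Nat.eq_dec m 1); [lia|].
      apply (scal_zero_r (V := C_NormedModule)).
    + change (proj1_sig z * 1 * 1 = proj1_sig z)%C; ring.
  - eexists; apply (is_series_single (V := R_NormedModule) _ 1).
    intros m Hm; unfold weighted_term, a; destruct (Nat.eq_dec m 1); [lia|].
    rewrite Cmod_0; change (0 ^ 2 * Rpower (INR m + 1) (2 * nu) = 0); ring.
Qed.

Lemma iter_comp_op phi n f z :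
  Nat.iter n (comp_op phi) f z = f (Nat.iter n phi z).
Proof.
  revert z; induction n as [|n IH]; intros z; [reflexivity|].
  simpl; unfold comp_op at 1; rewrite IH; f_equal.
  apply Nat.iter_swap.
Qed.

Lemma not_recurrent_of_orbit phi z0 alpha t nu :
  Cmod alpha = 1 -> 0 < Re t ->
  (forall n, proj1_sig (Nat.iter n phi z0) =
    (alpha * (1 - 2 * half_inv t (INR n)))%C) ->
  ~ recurrent nu (comp_op phi).
Proof.
  intros Ha Ht Hz Hrec.
  set (z := fun n => Nat.iter n phi z0) in *.
  (* From [|nu| < K + 1], the boundedness lemma applies with [S K], that is with [K + 3]
     differences. *)
  destruct (nfloor_ex (Rabs nu) (Rabs_pos nu)) as [K [_ HK]].
  rewrite <- S_INR in HK.
  pose proof (Rle_abs (- nu)) as Habs; rewrite Rabs_Ropp in Habs.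
  destruct (orbit_diff_bounded alpha t z Ha Ht Hz nu (S K) ltac:(lra))
    as [M HM].
  destruct (orbit_diff_identity_gap alpha t z Ha Ht Hz (S (S K)))
    as [d [Hd Hgap]].
  set (L := fun n (f : disk -> C) =>
    diff (S (S (S K))) (fun j => f (z (n + j)%nat))).
  set (f0 := fun w : disk => proj1_sig w).
  (* A bound [eta] strictly below [d / 2] and uniform in [n] leaves the slack that makes [U]
     open. *)
  set (U := fun f => in_S nu f /\ exists eta, eta < d / 2 /\
    forall n, Cmod (L n f - L n f0) <= eta).
  destruct (Hrec U) as [n [Hn [f [Hf HTf]]]].
  - split; [intros f [Hf _]; exact Hf|].
    intros f [_ [eta [Heta Hf]]].
    assert (HM' : 0 < Rabs M + 1) by (pose proof (Rabs_pos M); lra).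
    (* Half of the slack, divided by [|M| + 1], which is positive whatever the sign of [M]. *)
    exists ((d / 2 - eta) / 2 / (Rabs M + 1)); split.
    { repeat apply Rdiv_lt_0_compat; lra. }
    intros g Hg r Hr Hlt; split; [exact Hg|].
    exists (eta + (d / 2 - eta) / 2); split; [lra|]; intros n.
    replace (L n g - L n f0)%C with ((L n f - L n f0) + (L n g - L n f))%C by ring.
    eapply Rle_trans; [apply Cmod_triangle|].
    apply Rplus_le_compat; [apply Hf|].
    specialize (HM _ _ n Hr); cbv beta in HM; rewrite diff_minus in HM.
    fold (L n g) (L n f) in HM.
    apply Rle_trans with (1 := HM).
    apply (Rmult_lt_compat_l (Rabs M + 1)) in Hlt; [|lra].
    replace ((Rabs M + 1) * ((d / 2 - eta) / 2 / (Rabs M + 1)))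
      with ((d / 2 - eta) / 2) in Hlt by (field; lra).
    destruct Hr as [Hr0 _]; pose proof (Rle_abs M); nra.
  - exists f0; split; [apply in_S_identity|].
    exists 0; split; [lra|]; intros n.
    replace (L n f0 - L n f0)%C with (RtoC 0) by ring.
    rewrite Cmod_0; lra.
  - destruct Hf as [_ [e1 [He1 H1]]], HTf as [_ [e2 [He2 H2]]].
    specialize (H1 n); specialize (H2 0%nat); specialize (Hgap n Hn).
    (* Composition with [phi] shifts the orbit of [z0]. *)
    replace (L 0%nat (Nat.iter n (comp_op phi) f)) with (L n f) in H2.
    2: { apply diff_ext; intros j; rewrite iter_comp_op; unfold z.
         rewrite Nat.iter_add; reflexivity. }
    fold f0 in Hgap.
    change (d <= Cmod (L n f0 - L 0%nat f0)) in Hgap.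
    (* [L n f] is within [e1] of [L n f0] and within [e2] of [L 0 f0], and [e1 + e2 < d] contradicts
       the gap. *)
    pose proof (Cmod_triangle (- (L n f - L n f0)) (L n f - L 0%nat f0)) as Htr.
    rewrite Cmod_opp in Htr.
    replace (- (L n f - L n f0) + (L n f - L 0%nat f0))%C
      with (L n f0 - L 0%nat f0)%C in Htr by ring.
    lra.
Qed.

(** * Normal form of a parabolic self-map *)

Lemma disk_eq (z w : disk) : proj1_sig z = proj1_sig w -> z = w.
Proof.
  destruct z as [z Hz], w as [w Hw]; simpl; intros <-.
  f_equal; apply proof_irrelevance.
Qed.

Lemma Cmod_lt_1_iff z : Cmod z < 1 <-> Cmod z ^ 2 < 1.
Proof.
  pose proof (Cmod_ge_0 z); split; intros Hz; nra.
Qed.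

Definition disk_0 : disk.
Proof. exists 0%C; rewrite Cmod_0; lra. Defined.

Lemma INR_mult_unbounded a b : 0 < a -> exists n, (0 < n)%nat /\ b < INR n * a.
Proof.
  intros Ha.
  destruct (nfloor_ex (Rabs b / a)) as [n [_ Hn]].
  { apply Rdiv_le_0_compat; [apply Rabs_pos|exact Ha]. }
  exists (S n); split; [lia|]; rewrite S_INR.
  apply Rlt_div_l in Hn; [|exact Ha]; pose proof (Rle_abs b); lra.
Qed.

(* The translation by [kappa] in the coordinate [1 / (z - alpha)]. *)
Definition conj_translation (alpha kappa z : C) : C :=
  (alpha + (z - alpha) / (1 + kappa * (z - alpha)))%C.

(** The orbit of 0 is [n beta], which is unbounded unless [beta] vanishes. *)
Lemma translation_leaves_disk (beta : C) (phi : disk -> disk) :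
  (forall z, proj1_sig (phi z) = (proj1_sig z + beta)%C) -> beta = 0%C.
Proof.
  intros H; destruct (Ceq_dec beta 0) as [|Hb]; [assumption|exfalso].
  apply Cmod_gt_0 in Hb.
  destruct (INR_mult_unbounded _ 1 Hb) as [n [_ Hn]].
  assert (Hiter : proj1_sig (Nat.iter n phi disk_0) = (INR n * beta)%C).
  { clear Hn; induction n as [|n IH]; [simpl; ring|].
    rewrite S_INR, RtoC_plus; simpl; rewrite H, IH; ring. }
  pose proof (proj2_sig (Nat.iter n phi disk_0)) as Hlt; simpl in Hlt.
  rewrite Hiter, Cmod_mult, Cmod_R, Rabs_pos_eq in Hlt by apply pos_INR.
  lra.
Qed.

(** A finite fixed point is a double root by uniqueness, which gives the conjugate of a translation.
    If infinity is fixed, the map is affine: a translation, hence the identity as it preserves the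
    disk, or a map with a second, finite fixed point. *)
Lemma parabolic_self_map_form m phi :
  parabolic m -> restricts_to m phi ->
  exists alpha kappa : C, kappa <> 0%C /\ forall z : disk,
    (1 + kappa * (proj1_sig z - alpha))%C <> 0%C /\
    proj1_sig (phi z) = conj_translation alpha kappa (proj1_sig z).
Proof.
  intros [Hid [p [Hp Huniq]]] Hphi.
  destruct m as [a b c d det]; unfold restricts_to, lf_map in *; simpl in *.
  destruct p as [alpha|].
  - destruct (Ceq_dec c 0) as [Hc|Hc].
    { specialize (Huniq None); simpl in Huniq.
      destruct (Ceq_dec c 0); [|contradiction].
      discriminate (Huniq eq_refl). }
    destruct (Ceq_dec (c * alpha + d) 0) as [He|He]; [discriminate|].
    injection Hp as Hfix.
    set (e := (c * alpha + d)%C) in *.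
    assert (Hb : (b = alpha * e - a * alpha)%C).
    { rewrite <- Hfix at 1; field; exact He. }
    assert (Ha : (a = c * alpha + e)%C).
    { (* [alpha'] is the second root of the fixed point equation. *)
      set (alpha' := ((a - d) / c - alpha)%C).
      assert (He' : (c * alpha' + d = a - c * alpha)%C)
        by (unfold alpha'; field; exact Hc).
      assert (Hne : (a - c * alpha)%C <> 0%C).
      { intros H0; apply det.
        replace (a * d - b * c)%C with ((a - c * alpha) * e)%C
          by (rewrite Hb; unfold e; ring).
        rewrite H0; ring. }
      specialize (Huniq (Some alpha')); simpl in Huniq.
      destruct (Ceq_dec (c * alpha' + d) 0) as [H0|_];
        [rewrite He' in H0; contradiction|].
      assert (Heq : Some alpha = Some alpha').
      { apply Huniq; f_equal; rewrite He', Hb; unfold alpha', e; field; auto. }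
      injection Heq as Heq.
      rewrite <- Heq in He'; fold e in He'; rewrite He'; ring. }
    exists alpha, (c / e)%C; split.
    { intros H0; apply Hc; replace c with (c / e * e)%C by (field; exact He).
      rewrite H0; ring. }
    intros z; specialize (Hphi z).
    destruct (Ceq_dec (c * proj1_sig z + d) 0) as [|Hz]; [discriminate|].
    injection Hphi as Hphi; rewrite <- Hphi.
    assert (Hd : (c * proj1_sig z + d = e * (1 + c / e * (proj1_sig z - alpha)))%C).
    { replace (e * (1 + c / e * (proj1_sig z - alpha)))%C
        with (e + c * (proj1_sig z - alpha))%C by (field; exact He).
      unfold e; ring. }
    assert (Hn : (1 + c / e * (proj1_sig z - alpha))%C <> 0%C).
    { intros H0; apply Hz; rewrite Hd, H0; ring. }
    split; [exact Hn|].
    unfold conj_translation; rewrite Hd, Hb, Ha.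
    clearbody e; clear - Hn He.
    field; repeat split; auto.
    intros H0; apply Hn.
    transitivity ((e + c * (proj1_sig z - alpha)) / e)%C; [field; exact He|].
    rewrite H0; field; exact He.
  - exfalso.
    destruct (Ceq_dec c 0) as [Hc|]; [subst c|discriminate].
    assert (Hd : d <> 0%C) by (intros ->; apply det; ring).
    destruct (Ceq_dec a d) as [->|Hne].
    + apply Hid.
      assert (Hden : forall z : C, (0 * z + d)%C = d) by (intros z; ring).
      assert (Hb : (b / d = 0)%C).
      { apply (translation_leaves_disk _ phi); intros z; specialize (Hphi z).
        rewrite Hden in Hphi.
        destruct (Ceq_dec d 0); [contradiction|].
        injection Hphi as <-; field; exact Hd. }
      assert (b = 0%C) as ->.
      { transitivity (b / d * d)%C; [field; exact Hd|rewrite Hb; ring]. }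
      intros [z|]; [rewrite Hden|].
      * destruct (Ceq_dec d 0); [contradiction|].
        f_equal; field; exact Hd.
      * destruct (Ceq_dec 0 0); [reflexivity|congruence].
    + assert (Hda : (d - a)%C <> 0%C) by (apply Cminus_eq_contra; auto).
      specialize (Huniq (Some (b / (d - a))%C)); simpl in Huniq.
      replace (0 * (b / (d - a)) + d)%C with d in Huniq by ring.
      destruct (Ceq_dec d 0); [contradiction|].
      assert (Heq : None = Some (b / (d - a))%C); [|discriminate].
      apply Huniq; f_equal; field; auto.
Qed.

(** This is the vertical translation of the half-plane. The identity [Hid] compares numerator and
    denominator of the image. *)
Lemma conj_translation_disk alpha kappa W :
  Cmod alpha = 1 -> Re (alpha * kappa)%C = 0 -> Cmod (alpha + W) < 1 ->
  (1 + kappa * W)%C <> 0%C /\ Cmod (alpha + W / (1 + kappa * W)) < 1.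
Proof.
  intros Ha Hre HW; rewrite Cmod_lt_1_iff in HW.
  assert (Ha2 : Cmod alpha ^ 2 = 1) by (rewrite Ha; ring).
  assert (Hid : Cmod (alpha * (1 + kappa * W) + W) ^ 2 =
    Cmod alpha ^ 2 * Cmod (1 + kappa * W) ^ 2
    + Cmod (alpha + W) ^ 2 - Cmod alpha ^ 2
    + 2 * Cmod W ^ 2 * Re (alpha * kappa)%C).
  { rewrite !Cmod2_alt; destruct alpha, kappa, W; cbn; ring. }
  rewrite Hre, Ha2 in Hid.
  pose proof (pow2_ge_0 (Cmod (alpha * (1 + kappa * W) + W))) as Hsq.
  assert (Hn : (1 + kappa * W)%C <> 0%C).
  (* At a zero of the denominator a square would equal [|alpha + W| ^ 2 - 1 < 0]. *)
  { intros H0; rewrite H0 in Hid, Hsq; rewrite Cmod_0 in Hid; lra. }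
  split; [exact Hn|].
  replace (alpha + W / (1 + kappa * W))%C
    with ((alpha * (1 + kappa * W) + W) / (1 + kappa * W))%C
    by (field; exact Hn).
  rewrite Cmod_div by exact Hn.
  apply Cmod_gt_0 in Hn.
  apply Rlt_div_l; [exact Hn|]; rewrite Rmult_1_l.
  apply Rsqr_incrst_0; try apply Cmod_ge_0; rewrite !Rsqr_pow2; lra.
Qed.

(** * Iterates, the fixed point and the translation parameter *)

Section ParabolicSelfMap.

Variables (alpha kappa : C) (phi : disk -> disk).
Hypothesis kappa_neq_0 : kappa <> 0%C.
Hypothesis phi_form : forall z : disk,
  (1 + kappa * (proj1_sig z - alpha))%C <> 0%C /\
  proj1_sig (phi z) = conj_translation alpha kappa (proj1_sig z).

(** Translations in the coordinate [1 / (z - alpha)] add up. The non-vanishing says that no point of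
    the disk reaches infinity. *)
Lemma iter_conj_translation (z : disk) n :
  (1 + INR n * kappa * (proj1_sig z - alpha))%C <> 0%C /\
  proj1_sig (Nat.iter n phi z)
    = conj_translation alpha (INR n * kappa) (proj1_sig z).
Proof.
  unfold conj_translation.
  induction n as [|n [IH1 IH2]].
  - assert (H : (1 + INR 0 * kappa * (proj1_sig z - alpha))%C = 1%C)
      by (simpl; ring).
    rewrite H; split; [apply C1_nz|simpl; field].
  - simpl Nat.iter; destruct (phi_form (Nat.iter n phi z)) as [H1 H2].
    unfold conj_translation in H2; rewrite H2; rewrite IH2 in H1 |- *.
    set (Z := (proj1_sig z - alpha)%C) in *.
    (* The new denominator is that of [phi] at the [n]-th iterate times the old one. *)
    assert (HS : (1 + INR (S n) * kappa * Z =
      (1 + kappa * (alpha + Z / (1 + INR n * kappa * Z) - alpha))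
      * (1 + INR n * kappa * Z))%C).
    { rewrite S_INR, RtoC_plus; field; exact IH1. }
    rewrite HS; split; [apply Cmult_neq_0; assumption|].
    f_equal; field; split; [exact IH1|].
    intros H0; apply H1.
    transitivity ((1 + INR n * kappa * Z + kappa * Z) / (1 + INR n * kappa * Z))%C;
      [field; exact IH1|].
    replace (1 + INR n * kappa * Z + kappa * Z)%C with (RtoC 0) by
      (rewrite <- H0; ring).
    field; exact IH1.
Qed.

Lemma fixed_point_on_circle : Cmod alpha = 1.
Proof.
  pose proof kappa_neq_0 as Hk; apply Cmod_gt_0 in Hk.
  destruct (Rtotal_order (Cmod alpha) 1) as [Hlt|[Heq|Hgt]]; [|exact Heq|];
    exfalso.
  (* Otherwise some point of the disk reaches infinity in [n] steps. *)
  - destruct (INR_mult_unbounded ((1 - Cmod alpha) * Cmod kappa) 1)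
      as [n [Hn0 Hn]]; [nra|].
    apply lt_INR in Hn0; simpl in Hn0.
    assert (HnC : RtoC (INR n) <> 0%C).
    { intros H; apply RtoC_inj in H; lra. }
    (* This point is the pole of the [n]-th iterate; it is close to [alpha] for large [n]. *)
    assert (Hz : Cmod (alpha - / (INR n * kappa))%C < 1).
    { unfold Cminus; eapply Rle_lt_trans; [apply Cmod_triangle|].
      rewrite Cmod_opp, Cmod_inv, Cmod_mult, Cmod_R, Rabs_pos_eq
        by (lra || (apply Cmult_neq_0; assumption)).
      assert (/ (INR n * Cmod kappa) < 1 - Cmod alpha); [|lra].
      apply Rmult_lt_reg_r with (INR n * Cmod kappa); [nra|].
      rewrite Rinv_l by nra; nra. }
    destruct (iter_conj_translation
      (exist _ (alpha - / (INR n * kappa))%C Hz) n) as [H _].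
    apply H; simpl; field; auto.
  (* Otherwise the orbit of [0] leaves the disk, as it converges to [alpha]. *)
  - set (eta := Cmod alpha - 1).
    assert (Heta : 0 < eta) by (unfold eta; lra).
    (* An iterate in the disk needs [|D| <= |alpha| / eta], whereas [|D| >= n |kappa alpha| - 1]. *)
    destruct (INR_mult_unbounded (Cmod kappa * Cmod alpha)
                (Cmod alpha / eta + 1)) as [n [_ Hn]]; [nra|].
    destruct (iter_conj_translation disk_0 n) as [H1 H2].
    pose proof (proj2_sig (Nat.iter n phi disk_0)) as Hlt; cbv beta in Hlt.
    rewrite H2 in Hlt; unfold conj_translation in Hlt; simpl in H1, Hlt.
    set (D := (1 + INR n * kappa * (0 - alpha))%C) in *.
    pose proof (Cmod_triangle (alpha + (0 - alpha) / D) (- ((0 - alpha) / D)))%C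
      as Htr.
    replace (alpha + (0 - alpha) / D + - ((0 - alpha) / D))%C with alpha in Htr
      by ring.
    set (z := (alpha + (0 - alpha) / D)%C) in *.
    rewrite Cmod_opp, Cmod_div in Htr by exact H1.
    replace (0 - alpha)%C with (- alpha)%C in Htr by ring.
    rewrite Cmod_opp in Htr.
    pose proof H1 as HD; apply Cmod_gt_0 in HD.
    assert (HDle : Cmod D <= Cmod alpha / eta).
    { apply Rle_div_r; [exact Heta|].
      assert (Hle : eta <= Cmod alpha / Cmod D)
        by (unfold eta; lra).
      apply Rle_div_r in Hle; [lra|exact HD]. }
    pose proof (Cmod_triangle (- D) 1) as Htr2.
    rewrite Cmod_opp, Cmod_1 in Htr2.
    replace (- D + 1)%C with (INR n * kappa * alpha)%C in Htr2
      by (unfold D; ring).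
    rewrite !Cmod_mult, Cmod_R, Rabs_pos_eq in Htr2 by apply pos_INR.
    lra.
Qed.

(** The inverse is the translation by [- kappa], which [conj_translation_disk] keeps inside the
    disk. *)
Lemma conj_translation_automorphism :
  Re (alpha * kappa)%C = 0 -> disk_automorphism phi.
Proof.
  intros Hre; pose proof fixed_point_on_circle as Ha; split.
  - intros z w Hzw; apply (f_equal (@proj1_sig _ _)) in Hzw.
    destruct (phi_form z) as [Hz ->] in Hzw |- *.
    destruct (phi_form w) as [Hw ->] in Hzw |- *.
    apply disk_eq; unfold conj_translation in Hzw.
    set (Z := (proj1_sig z - alpha)%C) in *.
    set (W := (proj1_sig w - alpha)%C) in *.
    assert (HZW : (Z / (1 + kappa * Z) = W / (1 + kappa * W))%C).
    { transitivity (alpha + Z / (1 + kappa * Z) - alpha)%C;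
        [ring|rewrite Hzw; ring]. }
    assert (Z = W).
    (* In this form of [Z], replacing [Z / (1 + kappa Z)] by [W / (1 + kappa W)] leaves [W]. *)
    { transitivity (Z / (1 + kappa * Z) * (1 + kappa * Z) * (1 + kappa * W)
         - kappa * Z * W)%C; [field; exact Hz|].
      rewrite HZW; field; exact Hw. }
    replace (proj1_sig z) with (alpha + Z)%C by (unfold Z; ring).
    rewrite H; unfold W; ring.
  - intros w; set (W := (proj1_sig w - alpha)%C).
    destruct (conj_translation_disk alpha (- kappa) W Ha) as [Hn Hlt].
    + replace (alpha * - kappa)%C with (- (alpha * kappa))%C by ring.
      change (- Re (alpha * kappa)%C = 0); rewrite Hre; ring.
    + replace (alpha + W)%C with (proj1_sig w) by (unfold W; ring).
      apply (proj2_sig w).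
    + set (z := exist (fun z => Cmod z < 1) _ Hlt : disk).
      exists z; apply disk_eq.
      destruct (phi_form z) as [_ ->].
      unfold conj_translation; simpl.
      replace (alpha + W / (1 + - kappa * W) - alpha)%C
        with (W / (1 + - kappa * W))%C by ring.
      replace (1 + kappa * (W / (1 + - kappa * W)))%C
        with (/ (1 + - kappa * W))%C by (field; exact Hn).
      replace (proj1_sig w) with (alpha + W)%C by (unfold W; ring).
      field; exact Hn.
Qed.

(** As [(alpha + z) / (alpha - z) = - 1 - 2 alpha / (z - alpha)], translation by [kappa] becomes
    translation by [- 2 alpha kappa]. *)
Lemma parabolic_orbit :
  ~ disk_automorphism phi -> 0 < Re (- (2 * alpha * kappa))%C /\
  forall n, proj1_sig (Nat.iter n phi disk_0) =
    (alpha * (1 - 2 * half_inv (- (2 * alpha * kappa)) (INR n)))%C.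
Proof.
  intros Hna; set (t := (- (2 * alpha * kappa))%C).
  pose proof fixed_point_on_circle as Ha.
  assert (Hn : forall n, (2 + INR n * t)%C <> 0%C).
  { intros n H0; destruct (iter_conj_translation disk_0 n) as [H _].
    apply H; simpl; transitivity ((2 + INR n * t) / 2)%C.
    - unfold t; field; intros H2; apply RtoC_inj in H2; lra.
    - rewrite H0; field; intros H2; apply RtoC_inj in H2; lra. }
  assert (Horb : forall n, proj1_sig (Nat.iter n phi disk_0) =
    (alpha * (1 - 2 * half_inv t (INR n)))%C).
  { intros n; destruct (iter_conj_translation disk_0 n) as [H ->].
    unfold conj_translation, half_inv; simpl in *; specialize (Hn n).
    unfold t in *; field; split.
    { intros H0; apply Hn; refine (eq_trans _ H0); ring. }
    intros H0; apply H; refine (eq_trans _ H0); ring. }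
  split; [|exact Horb].
  (* Orbit points in the disk satisfy [|n t| < |2 + n t|]. Large [n] then excludes [Re t < 0], and
     [Re t = 0] would make [phi] an automorphism. *)
  assert (Hpos : forall n, 0 < 4 + 4 * INR n * Re t).
  { intros n; pose proof (proj2_sig (Nat.iter n phi disk_0)) as Hlt.
    cbv beta in Hlt; rewrite Horb in Hlt.
    replace (alpha * (1 - 2 * half_inv t (INR n)))%C
      with (alpha * (INR n * t / (2 + INR n * t)))%C in Hlt
      by (unfold half_inv; field; apply Hn).
    rewrite Cmod_mult, Ha, Rmult_1_l, Cmod_div, Cmod_mult, Cmod_R, Rabs_pos_eq
      in Hlt by (apply Hn || apply pos_INR).
    pose proof (Cmod2_denom t (INR n)) as HN.
    pose proof (Hn n) as HD; apply Cmod_gt_0 in HD.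
    apply Rlt_div_l in Hlt; [|exact HD].
    pose proof (Cmod_ge_0 t); pose proof (pos_INR n).
    assert (0 <= INR n * Cmod t) by (apply Rmult_le_pos; assumption).
    nra. }
  destruct (Rtotal_order (Re t) 0) as [Hlt|[Heq|Hgt]]; [| |exact Hgt]; exfalso.
  - destruct (INR_mult_unbounded (- Re t) 1) as [n [_ H]]; [lra|].
    specialize (Hpos n); nra.
  - apply Hna, conj_translation_automorphism.
    assert (Hre : Re t = -2 * Re (alpha * kappa)%C)
      by (unfold t; destruct alpha, kappa; cbn; ring).
    lra.
Qed.

End ParabolicSelfMap.

Theorem theorem2p8 (m : lin_frac) (phi : disk -> disk)
  (m_parabolic : parabolic m)
  (phi_restr : restricts_to m phi)
  (phi_not_aut : ~ disk_automorphism phi)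
  (nu : R) :
  ~ recurrent nu (comp_op phi).
Proof.
  destruct (parabolic_self_map_form m phi m_parabolic phi_restr)
    as (alpha & kappa & Hk & Hphi).
  destruct (parabolic_orbit alpha kappa phi Hk Hphi phi_not_aut) as [Ht Horb].
  exact (not_recurrent_of_orbit phi disk_0 alpha _ nu
           (fixed_point_on_circle alpha kappa phi Hk Hphi) Ht Horb).
Qed.
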